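(* Let $F$ be a field of characteristic not $2$ or $3$. Every multilinear polynomial identity of degree $3$ (for one bilinear operation, over $F$) which is satisfied by the dicommutator in every alternative dialgebra over $F$ is a consequence of right anticommutativity $a(bc)+a(cb)\equiv 0$.
   Context: A dialgebra is a vector space $D$ with two bilinear operations $\dashv,\vdash\colon D\times D\to D$. A 0-dialgebra is a dialgebra satisfying the left and right bar identities $(a\dashv b)\vdash c \equiv (a\vdash b)\vdash c$ and $a\dashv(b\dashv c)\equiv a\dashv(b\vdash c)$. In a dialgebra define $(a,b,c)_\dashv = (a\dashv b)\dashv c - a\dashv(b\dashv c)$, $(a,b,c)_\vdash = (a\vdash b)\vdash c - a\vdash(b\vdash c)$, $(a,b,c)_\times = (a\vdash b)\dashv c - a\vdash(b\dashv c)$. An alternative dialgebra is a 0-dialgebra satisfying $(a,b,c)_\dashv+(c,b,a)_\vdash\equiv 0$, $(a,b,c)_\dashv-(b,c,a)_\vdash\equiv 0$, $(a,b,c)_\times+(a,c,b)_\vdash\equiv 0$. The dicommutator in a dialgebra is the bilinear operation $\langle a,b\rangle = a\dashv b - b\vdash a$. A multilinear polynomial identity of degree $n$ for one bilinear operation is an element $I$ of the multilinear subspace of degree $n$ of the free nonassociative algebra over $F$ on $n$ generators; it is satisfied by the dicommutator in $D$ if $I$ vanishes for all values of the variables in $D$ when every product $xy$ is interpreted as $\langle x,y\rangle$. An identity is a consequence of a set of multilinear identities if it lies in the T-ideal (ideal closed under all endomorphisms) of the free nonassociative algebra that they generate, equivalently if it holds in every algebra over $F$ satisfying them. *)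

(* Defs.v *)
From HB Require Import structures.
From mathcomp Require Import all_boot all_algebra finmap.
From mathcomp.multinomials Require Import monalg.

Set Implicit Arguments.
Unset Strict Implicit.
Unset Printing Implicit Defensive.

Import GRing.Theory.
Local Open Scope ring_scope.

(* Algebras with one bilinear operation: no associativity, no unit. *)
Record naAlgebra (F : fieldType) := NAAlgebra {
  na_carrier :> lmodType F;
  na_mul : {bilinear na_carrier -> na_carrier -> na_carrier}
}.

(* [dleft a b] is a -| b and [dright a b] is a |- b. *)
Record dialgebra (F : fieldType) := Dialgebra {
  di_carrier :> lmodType F;
  dleft : {bilinear di_carrier -> di_carrier -> di_carrier};
  dright : {bilinear di_carrier -> di_carrier -> di_carrier}
}.

Section DialgebraIdentities.
Variables (F : fieldType) (D : dialgebra F).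
Local Notation "a -| b" := (dleft D a b) (at level 40, left associativity).
Local Notation "a |- b" := (dright D a b) (at level 40, left associativity).
Implicit Types a b c : D.

Record is_0dialgebra : Prop := Is0Dialgebra {
  left_bar : forall a b c, (a -| b) |- c = (a |- b) |- c;
  right_bar : forall a b c, a -| (b -| c) = a -| (b |- c)
}.

Definition assoc_left a b c : D := (a -| b) -| c - a -| (b -| c).
Definition assoc_right a b c : D := (a |- b) |- c - a |- (b |- c).
Definition assoc_inner a b c : D := (a |- b) -| c - a |- (b -| c).

Record is_alternative_dialgebra : Prop := IsAlternativeDialgebra {
  alt_0dialgebra : is_0dialgebra;
  alt_left_right : forall a b c, assoc_left a b c + assoc_right c b a = 0;
  alt_left_cycle : forall a b c, assoc_left a b c - assoc_right b c a = 0;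
  alt_inner_right : forall a b c, assoc_inner a b c + assoc_right a c b = 0
}.

Definition dicommutator a b : D := a -| b - b |- a.

Lemma dicommutator_bilinear : bilinear_for *:%R *:%R dicommutator.
Proof.
split=> u k x y; rewrite /dicommutator.
  by rewrite linearPl linearPr /= scalerBr opprD addrACA.
by rewrite linearPr linearPl /= scalerBr opprD addrACA.
Qed.

HB.instance Definition _ :=
  bilinear_isBilinear.Build F D D D *:%R *:%R dicommutator
    dicommutator_bilinear.

Definition dicommutator_algebra : naAlgebra F := NAAlgebra dicommutator.

End DialgebraIdentities.

(* Nonassociative monomials: the free magma on X; {malg F[magma X]} is then the
   free F-module on them. *)
Inductive magma (X : Type) : Type :=
| Var of X
| Prod of magma X & magma X.

Section MagmaChoice.
Variable X : choiceType.

Fixpoint magma_encode (t : magma X) : GenTree.tree X :=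
  match t with
  | Var x => GenTree.Leaf x
  | Prod s u => GenTree.Node 0 [:: magma_encode s; magma_encode u]
  end.

Fixpoint magma_decode (t : GenTree.tree X) : option (magma X) :=
  match t with
  | GenTree.Leaf x => Some (Var x)
  | GenTree.Node _ [:: s; u] =>
      if (magma_decode s, magma_decode u) is (Some s', Some u')
      then Some (Prod s' u') else None
  | _ => None
  end.

Lemma magma_encodeK : pcancel magma_encode magma_decode.
Proof. by elim=> //= s -> u ->. Qed.

HB.instance Definition _ := Choice.copy (magma X) (pcan_type magma_encodeK).

End MagmaChoice.

(* Left-to-right list of the variables occurring in a monomial. *)
Fixpoint leaves (X : Type) (t : magma X) : seq X :=
  match t with
  | Var x => [:: x]
  | Prod s u => leaves s ++ leaves u
  end.

(* Linear extension of a function on the basis of a free module. *)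
Section LinearExtension.
Variables (K : choiceType) (F : fieldType) (V : lmodType F) (h : K -> V).

Definition linext (f : {malg F[K]}) : V := \sum_(k <- msupp f) f@_k *: h k.

Lemma linextEw (d : {fset K}) (f : {malg F[K]}) :
  (msupp f `<=` d)%fset -> linext f = \sum_(k <- d) f@_k *: h k.
Proof.
move=> le_f_d; rewrite /linext (big_fset_incl _ le_f_d) // => k _ k_f.
by rewrite mcoeff_outdom ?scale0r.
Qed.

Lemma linext_linear : linear linext.
Proof.
move=> c f g; pose d := (msupp f `|` msupp g)%fset.
have le_f : (msupp f `<=` d)%fset by exact: fsubsetUl.
have le_g : (msupp g `<=` d)%fset by exact: fsubsetUr.
have le_fg : (msupp (c *: f + g) `<=` d)%fset.
  apply: fsubset_trans (msuppD_le _ _) _; rewrite fsubUset le_g andbT.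
  exact: fsubset_trans (msuppZ_le _ _) le_f.
rewrite (linextEw le_fg) (linextEw le_f) (linextEw le_g) scaler_sumr.
rewrite -big_split; apply: eq_bigr => k _ /=.
by rewrite mcoeffD mcoeffZ scalerDl scalerA.
Qed.

HB.instance Definition _ :=
  GRing.isLinear.Build F {malg F[K]} V *:%R linext linext_linear.

End LinearExtension.

Section FreeAlgebra.
Variables (F : fieldType) (X : choiceType).

Definition free_mul (f g : {malg F[magma X]}) : {malg F[magma X]} :=
  linext (fun s => linext (fun t => << Prod s t >>) g) f.

Lemma free_mul_bilinear : bilinear_for *:%R *:%R free_mul.
Proof.
split=> [g|f] c x y; first exact: linext_linear.
rewrite /free_mul {1 3 5}/linext /= scaler_sumr -big_split /=.
apply: eq_bigr => s _.
by rewrite linext_linear scalerDr !scalerA mulrC.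
Qed.

HB.instance Definition _ :=
  bilinear_isBilinear.Build F {malg F[magma X]} {malg F[magma X]}
    {malg F[magma X]} *:%R *:%R free_mul free_mul_bilinear.

Definition free_algebra : naAlgebra F := NAAlgebra free_mul.

Definition gen (x : X) : free_algebra := << Var x >>.

End FreeAlgebra.
Arguments gen F {X} x.

Section Identities.
Variables (F : fieldType) (X : choiceType).
Local Notation A := (free_algebra F X).

Fixpoint magma_eval (B : naAlgebra F) (v : X -> B) (t : magma X) : B :=
  match t with
  | Var x => v x
  | Prod s u => na_mul B (magma_eval v s) (magma_eval v u)
  end.

Definition poly_eval (B : naAlgebra F) (v : X -> B) (f : A) : B :=
  linext (magma_eval v) f.

Definition satisfies (B : naAlgebra F) (f : A) : Prop :=
  forall v : X -> B, poly_eval v f = 0.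

Record is_Tideal (J : A -> Prop) : Prop := IsTideal {
  Tideal0 : J 0;
  TidealD : forall f g, J f -> J g -> J (f + g);
  TidealZ : forall (c : F) f, J f -> J (c *: f);
  TidealMl : forall f g, J g -> J (na_mul A f g);
  TidealMr : forall f g, J f -> J (na_mul A f g);
  Tideal_endo : forall phi : {linear A -> A},
    (forall f g, phi (na_mul A f g) = na_mul A (phi f) (phi g)) ->
    forall f, J f -> J (phi f)
}.

(* Membership in the T-ideal generated by S, the least T-ideal containing S. *)
Definition consequence (S : A -> Prop) (f : A) : Prop :=
  forall J : A -> Prop, is_Tideal J -> (forall g, S g -> J g) -> J f.

End Identities.

(* Each variable occurs exactly once in each monomial of f. *)
Definition multilinear (F : fieldType) (n : nat) (f : free_algebra F 'I_n) :
    Prop :=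
  forall t, t \in msupp f -> perm_eq (leaves t) (enum 'I_n).

Definition right_anticommutativity (F : fieldType) : free_algebra F 'I_3 :=
  let a := gen F (@Ordinal 3 0 isT) in
  let b := gen F (@Ordinal 3 1 isT) in
  let c := gen F (@Ordinal 3 2 isT) in
  let mul := na_mul (free_algebra F 'I_3) in
  mul a (mul b c) + mul a (mul c b).

(* Main.v *)
(* In the alternative dialgebra A + M built from an A-bimodule M, by
   (a + m) -| (b + n) = ab + mb and (a + m) |- (b + n) = ab + an, the
   dicommutator has <m, a> = [m, a] and <a, m> = 0 for m in M and a in A.
   Evaluating an identity at one variable m in M and two variables a, b in A
   therefore only sees the monomials starting with m, and gives a relation
   between [[m, a], b], [[m, b], a] and [m, [a, b]].  These are independent in
   a 10-dimensional example when 6 <> 0, so the coefficients of the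
   (xy)z vanish and those of x(yz) and x(zy) agree. *)
Require Import Defs.
From HB Require Import structures.
From mathcomp Require Import all_boot all_algebra finmap ring.
From mathcomp.multinomials Require Import monalg.

Set Implicit Arguments.
Unset Strict Implicit.
Unset Printing Implicit Defensive.

Import GRing.Theory.
Local Open Scope ring_scope.

(** * A ten-dimensional alternative dialgebra of the form A + M *)

Section WitnessDialgebra.
Variable F : fieldType.

Definition witness : lmodType F :=
  (F^o * F^o * F^o * F^o * F^o * F^o * F^o * F^o * F^o * F^o)%type.

Definition coords (a b ab ba m ma mb w1 w2 t : F) : witness :=
  (a, b, ab, ba, m, ma, mb, w1, w2, t).

Lemma coordsP (P : witness -> Prop) :
  (forall a b ab ba m ma mb w1 w2 t, P (coords a b ab ba m ma mb w1 w2 t)) ->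
  forall x, P x.
Proof. by move=> Pc [[[[[[[[[a b] ab] ba] m] ma] mb] w1] w2] t]; apply: Pc. Qed.

(* A has basis a, b, ab, ba and A^3 = 0; M has basis m, ma, mb, w1, w2, t, where
   t = (m, a, b) is the alternating associator and the other products are
   (ma)b = w1, (mb)a = w2, m(ab) = w1 - t, m(ba) = w2 + t, am = bm = 0,
   a(mb) = t, b(ma) = - t, (ab)m = t, (ba)m = - t. *)
Definition witness_dleft (x y : witness) : witness :=
  let: (a, b, ab, ba, m, ma, mb, w1, w2, t) := x in
  let: (a', b', ab', ba', m', ma', mb', w1', w2', t') := y in
  coords 0 0 (a * b') (b * a') 0 (m * a') (m * b')
    (ma * b' + m * ab') (mb * a' + m * ba') (m * ba' - m * ab').

Definition witness_dright (x y : witness) : witness :=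
  let: (a, b, ab, ba, m, ma, mb, w1, w2, t) := x in
  let: (a', b', ab', ba', m', ma', mb', w1', w2', t') := y in
  coords 0 0 (a * b') (b * a') 0 0 0 0 0
    (a * mb' - b * ma' + ab * m' - ba * m').

Lemma regular_scaleE (k : F) (x : F^o) : k *: x = k * x.
Proof. by []. Qed.

Ltac coords_case x :=
  elim/coordsP: x => ? ? ? ? ? ? ? ? ? ?.

Lemma pair_ext (T U : Type) (x y : T * U) : x.1 = y.1 -> x.2 = y.2 -> x = y.
Proof. by case: x y => [? ?] [? ?] /= -> ->. Qed.

Ltac coords_ring :=
  do 9?[apply: pair_ext]; rewrite /= ?regular_scaleE; ring.

Lemma witness_dleft_bilinear : bilinear_for *:%R *:%R witness_dleft.
Proof.
by split=> z k x y; coords_case z; coords_case x; coords_case y; coords_ring.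
Qed.

Lemma witness_dright_bilinear : bilinear_for *:%R *:%R witness_dright.
Proof.
by split=> z k x y; coords_case z; coords_case x; coords_case y; coords_ring.
Qed.

HB.instance Definition _ :=
  bilinear_isBilinear.Build F witness witness witness *:%R *:%R witness_dleft
    witness_dleft_bilinear.
HB.instance Definition _ :=
  bilinear_isBilinear.Build F witness witness witness *:%R *:%R witness_dright
    witness_dright_bilinear.

Definition witness_dialgebra : dialgebra F :=
  Dialgebra witness_dleft witness_dright.

(** In coordinates, each of the five identities is a polynomial identity with integer
    coefficients. *)
Lemma witness_alternative : is_alternative_dialgebra witness_dialgebra.
Proof.
split; first split.
all: rewrite ?/assoc_left ?/assoc_right ?/assoc_inner /=.
all: move=> x y z; coords_case x; coords_case y; coords_case z.
all: by coords_ring.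
Qed.

End WitnessDialgebra.

(** * Linear extension from a basis *)

Lemma linext_uniq (K : choiceType) (F : fieldType) (V : lmodType F)
    (h : K -> V) (s : seq K) (f : {malg F[K]}) :
  uniq s -> {subset msupp f <= s} -> linext h f = \sum_(k <- s) f@_k *: h k.
Proof.
move=> uniq_s sub_fs; pose d := [fset k in s]%fset.
have sub_fd : (msupp f `<=` d)%fset.
  by apply/fsubsetP=> k /sub_fs k_s; rewrite inE.
rewrite (linextEw _ sub_fd); apply: perm_big; apply: uniq_perm => //.
by move=> k; rewrite inE.
Qed.

Lemma linext_basis (K : choiceType) (F : fieldType) (V : lmodType F)
    (h : K -> V) (k : K) : linext h << k >> = h k :> V.
Proof.
rewrite (@linext_uniq _ _ _ _ [:: k]) //.
  by rewrite big_seq1 mcoeffU eqxx scale1r.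
by move=> x; rewrite msuppU oner_eq0 !inE.
Qed.

Lemma malgUZ (K : choiceType) (F : fieldType) (c : F) (k : K) :
  << c *g k >> = c *: << k >> :> {malg F[K]}.
Proof. by apply/malgP=> x; rewrite mcoeffZ !mcoeffU mulrnAr mulr1. Qed.

Lemma linext_id (K : choiceType) (F : fieldType) (f : {malg F[K]}) :
  linext (fun k => << k >>) f = f.
Proof. by rewrite [RHS]monalgE; apply: eq_bigr => k _; rewrite -malgUZ. Qed.

(* Kept abstract in B and C: rewriting with phiM directly in the free algebra
   makes unification compare distinct products by unfolding free_mul. *)
Lemma morph_right_anticomm (F : fieldType) (B C : naAlgebra F) (phi : B -> C)
    (phiD : forall x y, phi (x + y) = phi x + phi y)
    (phiM : forall x y, phi (na_mul B x y) = na_mul C (phi x) (phi y))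
    (x y z : B) (x' y' z' : C) :
  phi x = x' -> phi y = y' -> phi z = z' ->
  phi (na_mul B x (na_mul B y z) + na_mul B x (na_mul B z y)) =
  na_mul C x' (na_mul C y' z') + na_mul C x' (na_mul C z' y').
Proof. by move=> <- <- <-; rewrite phiD !phiM. Qed.

(** * Evaluation as an algebra morphism, and substitution in T-ideals *)

Section Substitution.
Variables (F : fieldType) (X : choiceType).
Local Notation A := (free_algebra F X).

Lemma poly_evalD (B : naAlgebra F) (v : X -> B) (f g : A) :
  poly_eval v (f + g) = poly_eval v f + poly_eval v g.
Proof. exact: raddfD. Qed.

Lemma poly_eval_gen (B : naAlgebra F) (v : X -> B) (x : X) :
  poly_eval v (gen F x) = v x.
Proof. exact: linext_basis. Qed.

Lemma poly_evalM (B : naAlgebra F) (v : X -> B) (f g : A) :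
  poly_eval v (na_mul A f g) = na_mul B (poly_eval v f) (poly_eval v g).
Proof.
rewrite /= /free_mul {2}/poly_eval {1 3}/linext /poly_eval raddf_sum linear_sumlz.
apply: eq_bigr => s _ /=; rewrite linearZ linearZl_LR; congr (_ *: _).
rewrite /linext raddf_sum linear_sumr; apply: eq_bigr => t _ /=.
by rewrite linearZ /= linext_basis linearZr_LR.
Qed.

Lemma mul_monomial3 (s t u : magma X) :
  na_mul A << s >> (na_mul A << t >> << u >>) = << Prod s (Prod t u) >>.
Proof.
have mulU p q : free_mul << p >> << q >> = << Prod p q >> :> A.
  by rewrite /free_mul !linext_basis.
exact: etrans (congr1 (free_mul _) (mulU t u)) (mulU s _).
Qed.

(** With values in the free algebra itself, [poly_eval v] is linear and multiplicative, hence one of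
    the endomorphisms under which [J] is closed. *)
Lemma Tideal_subst (J : A -> Prop) (v : X -> A) (f : A) :
  is_Tideal J -> J f -> J (poly_eval v f).
Proof.
move=> J_ideal; apply: (Tideal_endo J_ideal (phi := linext (magma_eval v))).
exact: poly_evalM.
Qed.

End Substitution.

(** * The twelve multilinear monomials of degree three *)

Section DegreeThree.
Variable X : choiceType.

Definition lprod (p : X * X * X) : magma X :=
  Prod (Prod (Var p.1.1) (Var p.1.2)) (Var p.2).

Definition rprod (p : X * X * X) : magma X :=
  Prod (Var p.1.1) (Prod (Var p.1.2) (Var p.2)).

Lemma lprod_inj : injective lprod.
Proof. by move=> [[a b] c] [[a' b'] c'] [-> -> ->]. Qed.

Lemma rprod_inj : injective rprod.
Proof. by move=> [[a b] c] [[a' b'] c'] [-> -> ->]. Qed.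

Lemma leaves_gt0 (t : magma X) : (0 < size (leaves t))%N.
Proof. by elim: t => //= s _ u IHu; rewrite size_cat addn_gt0 IHu orbT. Qed.

Lemma leaves1 (t : magma X) a : leaves t = [:: a] -> t = Var a.
Proof.
case: t => [x [->] //|s u] /(congr1 size) /=; rewrite size_cat.
by move: (leaves_gt0 s) (leaves_gt0 u); case: size => // m; case: size => // n;
  rewrite addnS.
Qed.

Lemma leaves2 (t : magma X) a b : leaves t = [:: a; b] -> t = Prod (Var a) (Var b).
Proof.
case: t => [x //|s u] /=; case Es: (leaves s) => [|x [|y l]] /=.
- by move: (leaves_gt0 s); rewrite Es.
- by case=> <- /leaves1->; rewrite (leaves1 Es).
by case=> _ _; case: l {Es} => //= Eu; move: (leaves_gt0 u); rewrite Eu.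
Qed.

(** Neither factor has an empty word of leaves, so the left factor carries one or two of the three
    letters, which fixes the bracketing. *)
Lemma leaves3 (t : magma X) a b c : leaves t = [:: a; b; c] ->
  t = lprod (a, b, c) \/ t = rprod (a, b, c).
Proof.
case: t => [x //|s u] /=; case Es: (leaves s) => [|x [|y [|z l]]] /=.
- by move: (leaves_gt0 s); rewrite Es.
- by case=> <- /leaves2->; right; rewrite (leaves1 Es).
- by case=> <- <- /leaves1->; left; rewrite (leaves2 Es).
by case=> _ _ _; case: l {Es} => //= Eu; move: (leaves_gt0 u); rewrite Eu.
Qed.

Definition arrangements (i j k : X) : seq (X * X * X) :=
  [:: (i, j, k); (i, k, j); (j, i, k); (j, k, i); (k, i, j); (k, j, i)].

Lemma arrangements_uniq i j k : uniq [:: i; j; k] -> uniq (arrangements i j k).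
Proof.
rewrite /= !inE !xpair_eqE !eqxx !negb_or => /and3P[/andP[ij ik] jk _].
by rewrite !(eq_sym k) !(eq_sym j i) (negPf ij) (negPf ik) (negPf jk).
Qed.

Lemma perm_arrangements i j k a b c : uniq [:: i; j; k] ->
  perm_eq [:: a; b; c] [:: i; j; k] -> (a, b, c) \in arrangements i j k.
Proof.
move=> uniq_ijk perm_abc; have := perm_uniq perm_abc; rewrite uniq_ijk.
have mem_ijk x : x \in [:: a; b; c] -> [|| x == i, x == j | x == k].
  by rewrite (perm_mem perm_abc) !inE.
have := mem_ijk a; have := mem_ijk b; have := mem_ijk c.
rewrite !inE !eqxx !orbT => /(_ isT) + /(_ isT) + /(_ isT).
(* Of the 27 choices of [a], [b], [c] among [i], [j], [k], those with a repetition contradict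
   [uniq]; the other six are listed. *)
by do 3![case/or3P=> /eqP->]; rewrite /= !inE !eqxx ?orbT ?andbF //=.
Qed.

(** The grouping pairs arrangements with the same first letter, as right anticommutativity exchanges
    the last two. *)
Lemma sum_arrangements (V : nmodType) (h : X * X * X -> V) i j k :
  \sum_(p <- arrangements i j k) h p =
  (h (i, j, k) + h (i, k, j))
  + ((h (j, i, k) + h (j, k, i)) + (h (k, i, j) + h (k, j, i))).
Proof. by rewrite !big_cons big_nil addr0 !addrA. Qed.

Definition monomials (i j k : X) : seq (magma X) :=
  map lprod (arrangements i j k) ++ map rprod (arrangements i j k).

Lemma monomials_uniq i j k : uniq [:: i; j; k] -> uniq (monomials i j k).
Proof.
move=> uniq_ijk; rewrite cat_uniq; apply/and3P; split.
- by rewrite (map_inj_uniq lprod_inj) arrangements_uniq.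
- by apply/hasPn=> _ /mapP[p _ ->]; apply/negP=> /mapP[].
by rewrite (map_inj_uniq rprod_inj) arrangements_uniq.
Qed.

Lemma mem_monomials i j k (t : magma X) : uniq [:: i; j; k] ->
  perm_eq (leaves t) [:: i; j; k] -> t \in monomials i j k.
Proof.
move=> uniq_ijk perm_t; rewrite mem_cat.
case Et: (leaves t) (perm_size perm_t) => [|a [|b [|c [|d l]]]] // _.
have mem_abc: (a, b, c) \in arrangements i j k.
  by apply: perm_arrangements; rewrite // -Et.
by case: (leaves3 Et) => ->; rewrite map_f ?orbT.
Qed.

End DegreeThree.

(** * Coefficients of an identity satisfied in the witness, and its membership in the T-ideal *)

Section Identity.
Variables (F : fieldType) (f : free_algebra F 'I_3).
Hypotheses (char_neq2 : 2%N \notin [pchar F]) (char_neq3 : 3%N \notin [pchar F]).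
Hypothesis f_multilinear : multilinear f.
Hypothesis f_satisfied : satisfies (dicommutator_algebra (witness_dialgebra F)) f.

Lemma perm_enum_I3 (i j k : 'I_3) :
  uniq [:: i; j; k] -> perm_eq (enum 'I_3) [:: i; j; k].
Proof.
move=> uniq_ijk; rewrite perm_sym; apply: uniq_perm => //; first exact: enum_uniq.
have sub_ijk: {subset [:: i; j; k] <= enum 'I_3} by move=> x; rewrite mem_enum.
by case: (uniq_min_size uniq_ijk sub_ijk) => //; rewrite size_enum_ord.
Qed.

(** Serves both to evaluate [f] in the witness and, with [h] the basis map, to expand [f] itself. *)
Lemma multilinear_linext (V : lmodType F) (h : magma 'I_3 -> V) i j k :
  uniq [:: i; j; k] ->
  linext h f = \sum_(p <- arrangements i j k)
    (f@_(lprod p) *: h (lprod p) + f@_(rprod p) *: h (rprod p)).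
Proof.
move=> uniq_ijk; rewrite (linext_uniq _ (monomials_uniq uniq_ijk)).
  by rewrite big_cat !big_map [RHS]big_split.
move=> t /f_multilinear perm_t; apply: mem_monomials => //.
by apply: perm_trans perm_t _; apply: perm_enum_I3.
Qed.

Lemma coef_relations (i j k : 'I_3) : uniq [:: i; j; k] ->
  f@_(lprod (i, j, k)) = 0 /\ f@_(rprod (i, k, j)) = f@_(rprod (i, j, k)).
Proof.
(* The variables [i], [j], [k] take the values m, a, b. *)
move=> uniq_ijk; pose v x : witness F :=
  if x == i then coords 0 0 0 0 1 0 0 0 0 0 else
  if x == j then coords 1 0 0 0 0 0 0 0 0 0 else
  coords 0 1 0 0 0 0 0 0 0 0.
have := f_satisfied v; rewrite /poly_eval (multilinear_linext _ uniq_ijk).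
have vi : v i = coords 0 0 0 0 1 0 0 0 0 0 by rewrite /v eqxx.
have /and4P[ij ik jk _]: [&& i != j, i != k, j != k & true].
  by move: uniq_ijk; rewrite /= !inE negb_or !andbT -andbA.
have vj : v j = coords 1 0 0 0 0 0 0 0 0 0 by rewrite /v eq_sym (negPf ij) eqxx.
have vk : v k = coords 0 1 0 0 0 0 0 0 0 0.
  by rewrite /v !(eq_sym k) (negPf ik) (negPf jk).
rewrite !big_cons big_nil /= vi vj vk /dicommutator /=.
set x1 := f@_(lprod (i, j, k)); set x2 := f@_(lprod (i, k, j)).
set x3 := f@_(rprod (i, j, k)); set x4 := f@_(rprod (i, k, j)).
move=> eval0.
(* The surviving values are [[m, a], b] = w1 + t, [[m, b], a] = w2 - t and [m, [a, b]] = w1 - w2 -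
   4t = - [m, [b, a]]. The three relations are the coordinates of the sum at w1, w2 and t. *)
have eq1 : x1 + x3 - x4 = 0.
  rewrite -[RHS](congr1 (fun x : witness F => x.1.1.2) eval0) /=.
  by rewrite !regular_scaleE; ring.
have eq2 : x2 - x3 + x4 = 0.
  rewrite -[RHS](congr1 (fun x : witness F => x.1.2) eval0) /=.
  by rewrite !regular_scaleE; ring.
have eq3 : x1 - x2 - 4%:R * x3 + 4%:R * x4 = 0.
  rewrite -[RHS](congr1 (fun x : witness F => x.2) eval0) /=.
  by rewrite !regular_scaleE; ring.
have x43 : x4 = x3.
  apply/eqP; rewrite -subr_eq0; apply/eqP.
  (* This combination eliminates [x1] and [x2]; the factor 6 is split so that each characteristic
     hypothesis cancels one prime. *)
  have /eqP : 2%:R * (3%:R * (x4 - x3)) = 0.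
    transitivity ((x1 - x2 - 4%:R * x3 + 4%:R * x4) - (x1 + x3 - x4)
                  + (x2 - x3 + x4)); first by ring.
    by rewrite eq1 eq2 eq3 subr0 addr0.
  move: char_neq2 char_neq3; rewrite !inE /= !mulf_eq0.
  by move=> /negPf-> /negPf-> /eqP.
by split=> //; move: eq1; rewrite x43 addrK.
Qed.

Variable J : free_algebra F 'I_3 -> Prop.
Hypotheses (J_ideal : is_Tideal J) (J_rac : J (right_anticommutativity F)).

Lemma Tideal_rprod (i j k : 'I_3) :
  J (<< rprod (i, j, k) >> + << rprod (i, k, j) >>).
Proof.
(* The substitution sends the variables 0, 1, 2 to [i], [j], [k]. *)
pose v (x : 'I_3) : free_algebra F 'I_3 := gen F (nth i [:: i; j; k] x).
have eval_rac := morph_right_anticomm (poly_evalD v) (poly_evalM v)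
  (poly_eval_gen v (Ordinal (isT : 0 < 3)%N))
  (poly_eval_gen v (Ordinal (isT : 1 < 3)%N))
  (poly_eval_gen v (Ordinal (isT : 2 < 3)%N)).
suff <- : poly_eval v (right_anticommutativity F) =
    << rprod (i, j, k) >> + << rprod (i, k, j) >> by exact: Tideal_subst.
apply: etrans eval_rac _; apply: congr2.
  exact: (mul_monomial3 F (Var i) (Var j) (Var k)).
exact: (mul_monomial3 F (Var i) (Var k) (Var j)).
Qed.

Lemma Tideal_arrangement_pair (i j k : 'I_3) : uniq [:: i; j; k] ->
  J ((f@_(lprod (i, j, k)) *: << lprod (i, j, k) >>
      + f@_(rprod (i, j, k)) *: << rprod (i, j, k) >>)
     + (f@_(lprod (i, k, j)) *: << lprod (i, k, j) >>
      + f@_(rprod (i, k, j)) *: << rprod (i, k, j) >>)).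
Proof.
move=> uniq_ijk.
have uniq_ikj : uniq [:: i; k; j].
  by rewrite -(perm_uniq (s1 := [:: i; j; k])) // perm_cons (perm_catC [:: j]).
(* The second use, with [j] and [k] exchanged, kills the other left-bracketed coefficient; what
   remains is a multiple of the element in [Tideal_rprod]. *)
have [-> ->] := coef_relations uniq_ijk; have [-> _] := coef_relations uniq_ikj.
set c := f@_(rprod (i, j, k)).
have regroup (V : lmodType F) (x y z t : V) :
    (0 *: x + c *: y) + (0 *: z + c *: t) = c *: (y + t).
  by rewrite !scale0r !add0r scalerDr.
by rewrite regroup; apply: (TidealZ J_ideal); apply: Tideal_rprod.
Qed.

End Identity.

Theorem proposition16 (F : fieldType)
    (char_neq2 : 2%N \notin [pchar F]) (char_neq3 : 3%N \notin [pchar F])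
    (I : free_algebra F 'I_3) (I_multilinear : multilinear I)
    (I_satisfied : forall D : dialgebra F,
        is_alternative_dialgebra D -> satisfies (dicommutator_algebra D) I) :
  consequence (fun g => g = right_anticommutativity F) I.
Proof.
move=> J J_ideal /(_ _ erefl) J_rac.
have I_witness := I_satisfied _ (witness_alternative F).
pose o (m : nat) (lt_m3 : (m < 3)%N) : 'I_3 := Ordinal lt_m3.
have pair_J := Tideal_arrangement_pair char_neq2 char_neq3 I_multilinear
  I_witness J_ideal J_rac.
have uniq_o : uniq [:: o 0 isT; o 1 isT; o 2 isT] by [].
rewrite -(linext_id I) (multilinear_linext I_multilinear _ uniq_o).
rewrite sum_arrangements.
(* One pair for each choice of the first variable. *)
apply: (TidealD J_ideal); first exact: pair_J.
apply: (TidealD J_ideal); exact: pair_J.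
Qed.
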